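(* Let $(X,d)$ be a compact connected metric space and let $F: X \rightrightarrows X$ be a robust continuous multifunction. Then either: (1) $F$ possesses a unique minimal set, and it is Lyapunov stable; or (2) $F$ possesses infinitely many minimal sets, and every minimal set is Lyapunov stable. Further, for every minimal set $A$ and every open set $V\supseteq A$, there is a minimal set $B$ with $B \subseteq V \setminus A$. In case (1), if in addition $F$ is single-valued, i.e. $F[x]=\{f(x)\}$ for a function $f:X\to X$, then the unique minimal set is globally attractive: for all $x \in X$ the set $\bigcap_{N \in \mathbb{N}} \overline{\{f^{\circ n}(x) : n\ge N\}}$ is the unique minimal set.
   Context: A multifunction $F:X\rightrightarrows Y$ is a function from $X$ to $2^Y\setminus\{\emptyset\}$ (nonempty values); for $S\subseteq X$, $F[S]=\bigcup_{s\in S}F[s]$. For $B\subseteq Y$ put $F^+[B]=\{x\in X: F[x]\subseteq B\}$ and $F^-[B]=\{x\in X: F[x]\cap B\neq\emptyset\}$. $F$ is lower semicontinuous if $F^-[V]$ is open for every open $V\subseteq Y$, upper semicontinuous if $F^+[V]$ is open for every open $V\subseteq Y$, and continuous if it is both. For $F:X\rightrightarrows X$: $F^{\circ 0}[x]=\{x\}$, $F^{\circ n}[x]=F[F^{\circ(n-1)}[x]]$, and the reachable set is $R[F,C]=\bigcup_{n=0}^\infty F^{\circ n}[C]$ for $C\subseteq X$; write $R[F,x]=R[F,\{x\}]$ and $R[C]=R[F,C]$. For $\epsilon>0$ and $S\subseteq X$, $\mathcal{B}_\epsilon(S)=\bigcup_{s\in S}\{y\in X: d(s,y)<\epsilon\}$,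 and $F_\epsilon$ is the multifunction $F_\epsilon[x]=\mathcal{B}_\epsilon(F[x])$. The chain reachable set is $CR[F,C]=\bigcap_{\epsilon>0}\bigcup_{n=0}^\infty F_\epsilon^{\circ n}[C]$, where $F_\epsilon^{\circ n}$ is the $n$-fold composition of $F_\epsilon$; write $CR[F,x]=CR[F,\{x\}]$. $F$ is called robust if $\overline{R[F,x]}=CR[F,x]$ for all $x\in X$. A set $A\subseteq X$ is invariant if $F[A]\subseteq A$. A minimal set of $F$ is a closed, nonempty, invariant set $A$ such that every closed, nonempty, invariant $B\subseteq A$ equals $A$. A set $A\subseteq X$ is Lyapunov stable if for every open $V\supseteq A$ there is an open $W\supseteq A$ with $R[W]\subseteq V$. *)

(* Defs.v *)
From mathcomp Require Import all_boot all_order all_algebra.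
From mathcomp Require Import all_classical all_reals all_analysis.

Set Implicit Arguments.
Unset Strict Implicit.
Unset Printing Implicit Defensive.

Import Order.TTheory GRing.Theory Num.Theory.

Local Open Scope classical_set_scope.
Local Open Scope ring_scope.

(* A map F : X -> set Y is a multifunction when its values are nonempty; the
   operations below are defined for arbitrary set-valued maps. *)
Definition multifunction (X Y : Type) (F : X -> set Y) : Prop :=
  forall x, F x !=set0.

Definition mimage (X Y : Type) (F : X -> set Y) (S : set X) : set Y :=
  \bigcup_(s in S) F s.

(* F^+[B] *)
Definition upper_preimage (X Y : Type) (F : X -> set Y) (B : set Y) : set X :=
  [set x | F x `<=` B].

(* F^-[B] *)
Definition lower_preimage (X Y : Type) (F : X -> set Y) (B : set Y) : set X :=
  [set x | F x `&` B !=set0].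

Definition lsc (X Y : topologicalType) (F : X -> set Y) : Prop :=
  forall V : set Y, open V -> open (lower_preimage F V).

Definition usc (X Y : topologicalType) (F : X -> set Y) : Prop :=
  forall V : set Y, open V -> open (upper_preimage F V).

Definition mcontinuous (X Y : topologicalType) (F : X -> set Y) : Prop :=
  lsc F /\ usc F.

Fixpoint miter (X : Type) (F : X -> set X) (n : nat) (x : X) : set X :=
  if n is m.+1 then mimage F (miter F m x) else [set x].

Definition reach (X : Type) (F : X -> set X) (C : set X) : set X :=
  \bigcup_n mimage (miter F n) C.

Definition set_ball (R : realType) (X : metricType R) (e : R) (S : set X) :
    set X :=
  \bigcup_(s in S) [set y | mdist s y < e].

Definition fatten (R : realType) (X : metricType R) (F : X -> set X) (e : R) :
    X -> set X :=
  fun x => set_ball e (F x).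

Definition chain_reach (R : realType) (X : metricType R) (F : X -> set X)
    (C : set X) : set X :=
  \bigcap_(e in [set e : R | 0 < e]) \bigcup_n mimage (miter (fatten F e) n) C.

Definition robust (R : realType) (X : metricType R) (F : X -> set X) : Prop :=
  forall x, closure (reach F [set x]) = chain_reach F [set x].

Definition minvariant (X : Type) (F : X -> set X) (A : set X) : Prop :=
  mimage F A `<=` A.

Definition minimal_set (X : topologicalType) (F : X -> set X) (A : set X) :
    Prop :=
  [/\ closed A, A !=set0, minvariant F A &
      forall B : set X, closed B -> B !=set0 -> minvariant F B ->
        B `<=` A -> B = A].

Definition lyapunov_stable (X : topologicalType) (F : X -> set X)
    (A : set X) : Prop :=
  forall V : set X, open V -> A `<=` V ->
    exists W : set X, [/\ open W, A `<=` W & reach F W `<=` V].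

(* Main.v *)
Require Import Defs.
From mathcomp Require Import all_boot all_order all_algebra.
From mathcomp Require Import all_classical all_reals all_analysis.

Import Order.TTheory GRing.Theory Num.Theory.

Local Open Scope classical_set_scope.
Local Open Scope ring_scope.

(** Call the basin of a minimal set A the set of points x with A contained in
    the closure of R[x].

    Robustness says that a minimal set A is the chain reachable set of each of
    its points a, that is, the intersection of the sets of points reachable
    from a by chains with errors below e.  These sets are open apart from their
    starting point, are invariant, and nest together with their closures; so by
    compactness they are arbitrarily small open invariant neighbourhoods of A
    ([minimal_set_nbhs]).  Lyapunov stability of every minimal set follows at
    once.

    The dichotomy comes from connectedness.  The basin of A is closed
    ([closed_basin]): by robustness, membership means that a point of A is chain
    reachable from x, and chain reachability is a closed relation for an upper
    semicontinuous map.  Suppose that some neighbourhood V of A contains no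
    minimal set outside A.  A small invariant neighbourhood W of A then lies in
    the basin, because the orbit closure of any of its points stays in V and
    contains a minimal set, which can only be A.  Hence the basin consists of
    the points from which W can be reached, which is an open condition by lower
    semicontinuity ([open_basin]).  A nonempty clopen basin is the whole space,
    and then every other minimal set contains A, so equals A.  Therefore, when A
    is not the only minimal set, minimal sets accumulate at A
    ([minimal_set_not_isolated]); since distinct minimal sets are disjoint and
    closed, this forces infinitely many of them.

    For a single-valued map with a unique minimal set A, every closed tail of an
    orbit contains a minimal set, hence A; and once the orbit has entered a
    small invariant neighbourhood of A it never leaves, so the omega-limit set
    is no larger than A ([omega_limit_minimal]). *)

(** * Reachable sets as least invariant sets *)

Lemma subset_reach {X : Type} (F : X -> set X) (C : set X) : C `<=` reach F C.
Proof. by move=> x Cx; exists 0%N => //; exists x. Qed.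

Lemma reach_invariant {X : Type} (F : X -> set X) (C : set X) :
  minvariant F (reach F C).
Proof.
by move=> y [z [n _ [c Cc cz]] zy]; exists n.+1 => //; exists c => //; exists z.
Qed.

(** Together with [subset_reach] and [reach_invariant] this characterizes
    [reach F C] as the least invariant set containing [C], so that bounding a
    reachable set from above amounts to checking invariance.  It applies to [fatten F e] as well, whose
    reachable sets are the ones intersected in [chain_reach]. *)
Lemma reach_least {X : Type} {F : X -> set X} {C S : set X} :
  C `<=` S -> minvariant F S -> reach F C `<=` S.
Proof.
move=> CS invS y [n _ [c Cc]]; elim: n y => [y ->|n IH y [z /IH Sz zy]].
  exact: CS.
by apply: invS; exists z.
Qed.

(** Separates the starting points from the points reached after at least one
    step.  For a fattened map only the latter form an open set. *)
Lemma reach_split {X : Type} (F : X -> set X) (C : set X) :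
  reach F C `<=` C `|` mimage F (reach F C).
Proof.
apply: reach_least => [x Cx|y [z zS zy]]; first by left.
right; exists z => //; case: zS; last exact: reach_invariant.
exact: subset_reach.
Qed.

Lemma reach_trans {X : Type} {F : X -> set X} {C : set X} {y : X} :
  reach F C y -> reach F [set y] `<=` reach F C.
Proof.
by move=> Cy; apply: reach_least; [move=> _ ->|exact: reach_invariant].
Qed.

(** * Lower semicontinuity and minimal sets *)

(** If [y] is a value of [F] at a limit [x] of [S], lower semicontinuity makes
    points of [S] near [x] have values near [y]. *)
Lemma closure_invariant {X : topologicalType} {F : X -> set X} {S : set X} :
  lsc F -> minvariant F S -> minvariant F (closure S).
Proof.
move=> lscF invS y [x Sx xy] V; rewrite nbhsE => -[U [oU Uy] UV].
have [z [Sz [w [zw Uw]]]] : S `&` lower_preimage F U !=set0.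
  by apply: Sx; apply: open_nbhs_nbhs; split; [exact: lscF|exists y].
by exists w; split; [apply: invS; exists z|exact: UV].
Qed.

(** Reaching [W] in [n.+1] steps is reaching the open set
    [lower_preimage F W] in [n] steps. *)
Lemma open_reaching {X : topologicalType} {F : X -> set X} {W : set X} :
  lsc F -> open W -> open [set x | reach F [set x] `&` W !=set0].
Proof.
move=> lscF oW.
have -> : [set x | reach F [set x] `&` W !=set0] =
    \bigcup_n [set x | miter F n x `&` W !=set0].
  apply/seteqP; split=> x /=.
    by move=> [y [[n _ [_ -> xy]] Wy]]; exists n => //; exists y.
  move=> [n _ [y [xy Wy]]]; exists y; split=> //.
  by exists n => //; exists x.
apply: bigcup_open => n _; elim: n W oW => [|n IH] W oW.
  rewrite (_ : mkset _ = W)//; apply/seteqP; split=> x /=.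
    by move=> [_ [-> ]].
  by move=> Wx; exists x.
rewrite (_ : mkset _ = [set x | miter F n x `&` lower_preimage F W !=set0]).
  by apply: IH; exact: lscF.
apply/seteqP; split=> x /=.
  by move=> [y [[z xz zy] Wy]]; exists z; split=> //; exists y.
by move=> [z [xz [y [zy Wy]]]]; exists y; split=> //; exists z.
Qed.

(** The intersection with [B] is a nonempty closed invariant subset of the
    minimal set [A], hence all of it. *)
Lemma minimal_set_sub {X : topologicalType} {F : X -> set X} {A B : set X} :
  minimal_set F A -> closed B -> minvariant F B -> A `&` B !=set0 -> A `<=` B.
Proof.
move=> [cA _ invA minA] cB invB AB0.
rewrite -(minA (A `&` B)) //; first exact: closedI.
move=> y [x [Ax Bx] xy]; split; first by apply: invA; exists x.
by apply: invB; exists x.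
Qed.

Lemma minimal_set_eq {X : topologicalType} {F : X -> set X} {A B : set X} :
  minimal_set F A -> minimal_set F B -> A `&` B !=set0 -> A = B.
Proof.
move=> mA mB AB; have [cA _ iA _] := mA; have [cB _ iB _] := mB.
apply/seteqP; split; first exact: minimal_set_sub mA cB iB AB.
by apply: minimal_set_sub mB cA iA _; rewrite setIC.
Qed.

(** Zorn's lemma, with compactness giving the lower bound of a chain.  It is
    applied to the complements [U] of the closed invariant sets that meet [C],
    rather than are contained in [C]: this way the empty chain, whose union has
    the whole space as complement, needs no separate treatment. *)
Lemma exists_minimal_set {X : topologicalType} {F : X -> set X} {C : set X} :
  compact [set: X] -> closed C -> C !=set0 -> minvariant F C ->
  exists2 A, minimal_set F A & A `<=` C.
Proof.
move=> cptX cC C0 invC.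
pose P (U : set X) :=
  [/\ closed (~` U), minvariant F (~` U) & ~` U `&` C !=set0].
have [Us Usub Utot|U [[cU iU U0] maxU]] := @Zorn_bigcup X P.
  rewrite /P setC_bigcup; split.
  - by apply: closed_bigI => U /Usub[].
  - move=> y [x Ux xy] U UU; have [_ iU _] := Usub _ UU.
    by apply: iU; exists x => //; exact: Ux.
  have [Us0|Us0] := pselect (Us !=set0); last first.
    by case: C0 => x Cx; exists x; split=> // U UU; case: Us0; exists U.
  (* A cluster point of the filter generated by the chain of closed sets
     belongs to all of them. *)
  have FF : ProperFilter (filter_from Us (fun U => ~` U `&` C)).
    apply: filter_from_proper => [|U /Usub[]//].
    apply: filter_from_filter => // U V UU UV.
    by case: (Utot U V UU UV) => UV'; [exists V|exists U] => // x [nx Cx];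
      do !split=> //; move=> /UV'.
  have [|x [_ clx]] := cptX _ FF.
    exact: filterT.
  exists x; split.
    move=> U UU; have [cU _ _] := Usub _ UU; apply: cU => B Bx.
    have [|y [[nUy _] By]] := clx (~` U `&` C) B _ Bx; first by exists U.
    by exists y.
  apply: cC => B Bx; case: Us0 => U UU.
  have [|y [[_ Cy] By]] := clx (~` U `&` C) B _ Bx; first by exists U.
  by exists y.
exists (~` U `&` C) => //; split=> //; first exact: closedI.
  move=> y [x [Ux Cx] xy]; split; first by apply: iU; exists x.
  by apply: invC; exists x.
move=> B cB B0 iB BU.
have UB : U `<=` ~` B by move=> x Ux /BU[].
suff <- : ~` B = U.
  by rewrite setCK; apply/seteqP; split=> [x /[dup] Bx /BU[]|x []].
apply: contrapT => BneU; apply: (maxU (~` B)).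
  by rewrite properEneq; split=> //; apply/eqP => /esym.
split; rewrite ?setCK//.
by case: B0 => x Bx; exists x; split=> //; case: (BU x).
Qed.

Lemma minimal_set_reach {X : topologicalType} {F : X -> set X} {A : set X}
    {a : X} :
  lsc F -> minimal_set F A -> A a -> closure (reach F [set a]) = A.
Proof.
move=> lscF mA Aa; have [cA _ iA _] := mA; apply/seteqP; split.
  rewrite [X in _ `<=` X](closure_id _).1//; apply: closureS.
  by apply: reach_least => // _ ->.
apply: (minimal_set_sub mA); first exact: closed_closure.
  exact: closure_invariant (reach_invariant _ _).
by exists a; split=> //; apply: subset_closure; exact: subset_reach.
Qed.

(** * Chains with small errors *)

Section Metric.
Context {R : realType} {X : metricType R} {F : X -> set X}.

Lemma half_le (e : R) : 0 < e -> e / 2 <= e.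
Proof. by move=> e0; rewrite ler_pdivrMr// ler_pMr// ler1n. Qed.

Lemma set_ball_trans (e d : R) (S T : set X) :
  T `<=` set_ball d S -> set_ball e T `<=` set_ball (d + e) S.
Proof.
move=> TS z [y /TS[x Sx /= xy] /= yz]; exists x => //=.
by rewrite (le_lt_trans (metric_triangle _ y _))// ltrD.
Qed.

Lemma open_set_ball (e : R) (S : set X) : open (set_ball e S).
Proof.
rewrite openE => y [x Sx /= xy]; rewrite /interior -nbhs_ballE.
exists (e - mdist x y) => /=; first by rewrite subr_gt0.
rewrite ballEmdist => z /= yz; exists x => //=.
by rewrite (le_lt_trans (metric_triangle _ y _))// -ltrBrDl.
Qed.

Lemma closure_sub_set_ball (e : R) (S : set X) :
  0 < e -> closure S `<=` set_ball e S.
Proof.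
move=> e0 y Sy; have [x [Sx]] := Sy _ (nbhsx_ballx y _ e0).
by rewrite ballEmdist /= metric_sym => xy; exists x.
Qed.

Lemma sub_set_ball (e : R) (S : set X) : 0 < e -> S `<=` set_ball e S.
Proof. by move=> e0 x Sx; exists x => //=; rewrite mdistxx. Qed.

Lemma set_ballS (d e : R) (S : set X) :
  d <= e -> set_ball d S `<=` set_ball e S.
Proof. by move=> de y [x Sx /= xy]; exists x => //=; exact: lt_le_trans de. Qed.

Lemma fatten_reachS (d e : R) (C : set X) :
  d <= e -> reach (fatten F d) C `<=` reach (fatten F e) C.
Proof.
move=> de; apply: reach_least; first exact: subset_reach.
move=> z [x Cx xz]; apply: reach_invariant; exists x => //.
exact: set_ballS xz.
Qed.

(** Only the error of the last step has to grow to absorb the passage to the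
    closure; the starting point, reached in no step, is closed by itself. *)
Lemma closure_fatten_reach (e : R) (x : X) : 0 < e ->
  closure (reach (fatten F (e / 2)) [set x]) `<=` reach (fatten F e) [set x].
Proof.
move=> e0; have e20 : 0 < e / 2 by rewrite divr_gt0.
move=> y /(closureS (reach_split _ _)); rewrite closureU => -[].
  rewrite -(closure_id _).1; first exact: subset_reach.
  exact/accessible_closed_set1/hausdorff_accessible/metric_hausdorff.
move=> /(closure_sub_set_ball _ _ e20) [z [w xw wz] /= zy].
apply: reach_invariant; exists w.
  exact: fatten_reachS (half_le e e0) _ xw.
rewrite /fatten [e in set_ball e]splitr; apply: (set_ball_trans _ _ _ [set z]).
  by move=> _ ->.
by exists z.
Qed.

(** The sets reachable with error [e] decrease with [e] and nest together with
    their closures ([closure_fatten_reach]), so compactness of the complement of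
    [V] replaces their intersection by one of them. *)
Lemma chain_reach_approx {V : set X} {x : X} : compact [set: X] -> open V ->
  chain_reach F [set x] `<=` V ->
  exists2 e : R, 0 < e & reach (fatten F e) [set x] `<=` V.
Proof.
move=> cptX oV CV.
have cptV : compact (~` V).
  by apply: subclosed_compact cptX _ => //; exact: open_closedC.
have /compact_near_coveringP/(_ R (0%R : R)^'+
  (fun e y => ~ reach (fatten F e) [set x] y)) := cptV.
case=> [y Vy|d /= d0 dP]; last first.
  exists (d / 2); first by rewrite divr_gt0.
  move=> y xy; apply: contrapT => Vy; apply: (dP (d / 2)) Vy xy => /=.
    by rewrite sub0r normrN gtr0_norm ?divr_gt0// ltr_pdivrMr// ltr_pMr// ltr1n.
  by rewrite divr_gt0.
have [e [e0 xye]] : exists e : R, 0 < e /\ ~ reach (fatten F e) [set x] y.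
  apply: contrapT => ne; apply: Vy; apply: CV => e /= e0.
  by apply: contrapT => xy; apply: ne; exists e.
have e20 : 0 < e / 2 by rewrite divr_gt0.
exists (~` closure (reach (fatten F (e / 2)) [set x]), [set d | d <= e / 2]).
  split=> /=.
    apply: open_nbhs_nbhs; split.
      by apply: closed_openC; exact: closed_closure.
    by move=> /(closure_fatten_reach _ _ e0).
  exact: nbhs_right_le.
move=> [z d] /= [nz de] xz; apply: nz; apply: subset_closure.
exact: fatten_reachS xz.
Qed.

(** * Invariant neighbourhoods of minimal sets *)

(** The neighbourhood is the set of points reached from a point [a] of [A] by
    chains with small errors, in at least one step so as to make it open. *)
Lemma minimal_set_nbhs {A V : set X} : compact [set: X] -> multifunction F ->
    lsc F -> robust F -> minimal_set F A -> open V -> A `<=` V ->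
  exists W, [/\ open W, A `<=` W, minvariant F W & closure W `<=` V].
Proof.
move=> cptX F0 lscF robF mA oV AV; have [cA [a Aa] iA _] := mA.
have [|e e0 eV] := chain_reach_approx (x := a) cptX oV.
  by rewrite -robF (minimal_set_reach lscF mA Aa).
have e20 : 0 < e / 2 by rewrite divr_gt0.
pose G := fatten F (e / 2); pose W := mimage G (reach G [set a]).
have Wa : W `<=` reach G [set a] by exact: reach_invariant.
have iW : minvariant G W by move=> y [x /Wa]; exists x.
(* Whether [a] itself lies in [W] is not yet known; a value [b] of [F] at [a]
   does, and every point of [A] is chain reachable from [b]. *)
have [b ab] := F0 a.
have Ab : A b by apply: iA; exists a.
have Wb : W b.
  exists a; first exact: subset_reach.
  exact: sub_set_ball ab.
exists W; split.
- by apply: bigcup_open => x _; exact: open_set_ball.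
- rewrite -(minimal_set_reach lscF mA Ab) robF => y /(_ _ e20).
  by apply: reach_least => // _ ->.
- move=> y [x Wx xy]; apply: iW; exists x => //.
  exact: sub_set_ball xy.
- apply: subset_trans eV; apply: subset_trans (closure_fatten_reach _ _ e0).
  exact: closureS.
Qed.

(** * Basins are clopen unless minimal sets accumulate *)

Definition basin (A : set X) : set X :=
  [set x | A `<=` closure (reach F [set x])].

Lemma basinP {A : set X} {a x : X} : lsc F -> minimal_set F A -> A a ->
  closure (reach F [set x]) a -> basin A x.
Proof.
move=> lscF mA Aa xa; apply: (minimal_set_sub mA); first exact: closed_closure.
  exact: closure_invariant (reach_invariant _ _).
by exists a.
Qed.

Lemma basin_back {A : set X} {x y : X} :
  reach F [set x] y -> basin A y -> basin A x.
Proof.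
by move=> xy Ay; apply: subset_trans Ay _; exact/closureS/reach_trans.
Qed.

(** For [x] a limit of points [y] of the basin, upper semicontinuity puts the
    values of [F] at a nearby [y] among the values of [F] at [x] up to a small
    error; so a chain from [y] to [A] becomes a chain from [x] once its first
    step is taken from [x]. *)
Lemma closed_basin {A : set X} : multifunction F -> mcontinuous F ->
  robust F -> minimal_set F A -> closed (basin A).
Proof.
move=> F0 [lscF uscF] robF mA x clx; have [cA [a Aa] iA _] := mA.
apply: (basinP lscF mA Aa); rewrite robF => e /= e0.
have e20 : 0 < e / 2 by rewrite divr_gt0.
have [y [Ay xy]] : basin A `&` upper_preimage F (set_ball (e / 2) (F x)) !=set0.
  apply: clx; apply: open_nbhs_nbhs; split.
    by apply: uscF; exact: open_set_ball.
  exact: sub_set_ball.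
have yFx : fatten F (e / 2) y `<=` fatten F e x.
  by rewrite /fatten [e in X in _ `<=` X]splitr; exact: set_ball_trans.
have xFx : fatten F e x `<=` reach (fatten F e) [set x].
  move=> z xz; apply: reach_invariant; exists x => //; exact: subset_reach.
have yx : reach (fatten F (e / 2)) [set y] `<=`
    [set y] `|` reach (fatten F e) [set x].
  apply: reach_least => [z ->|z [w [->|xw] wz]]; first by left.
    by right; apply/xFx/yFx.
  right; apply: reach_invariant; exists w => //.
  exact: set_ballS (half_le e e0) _ wz.
(* The chain from [y] to [a] may have no step to replace, when [y = a].  Then
   a value [b] of [F] at [a] is one step away from [x], and robustness with
   minimality gives a chain from [b] to [a]. *)
have := Ay a Aa; rewrite robF => /(_ _ e20)/yx[ay|//].
have [b yb] := F0 y.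
have Ab : A b by apply: iA; exists y => //; rewrite -ay.
move: Aa; rewrite -(minimal_set_reach lscF mA Ab) robF => /(_ _ e0).
by apply/reach_trans/xFx/yFx; exact: sub_set_ball yb.
Qed.

(** If a neighbourhood of [A] lies in its basin, a point belongs to the basin as
    soon as it can reach that neighbourhood. *)
Lemma open_basin {A W : set X} : lsc F -> open W -> A `<=` W ->
  W `<=` basin A -> A !=set0 -> open (basin A).
Proof.
move=> lscF oW AW WA [a Aa].
rewrite (_ : basin A = [set x | reach F [set x] `&` W !=set0]).
  exact: open_reaching.
apply/seteqP; split=> x /=.
  by move=> /(_ a Aa); apply; apply: open_nbhs_nbhs; split=> //; exact: AW.
by move=> [y [xy /WA]]; exact: basin_back.
Qed.

(** Otherwise the basin of [A] would be a neighbourhood of [A], hence clopen,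
    hence everything, and [B] would contain [A]. *)
Lemma minimal_set_not_isolated {A B V : set X} :
    compact [set: X] -> connected [set: X] ->
    multifunction F -> mcontinuous F -> robust F ->
    minimal_set F A -> minimal_set F B -> A <> B -> open V -> A `<=` V ->
  exists C, minimal_set F C /\ C `<=` V `\` A.
Proof.
move=> cptX conX F0 ctsF robF mA mB AB oV AV; apply: contrapT => nC.
have [lscF _] := ctsF; have [cA A0 iA _] := mA.
have [W [oW AW iW WV]] := minimal_set_nbhs cptX F0 lscF robF mA oV AV.
have Wbasin : W `<=` basin A.
  move=> x Wx.
  have [|||C mC Cx] := @exists_minimal_set X F (closure (reach F [set x])) cptX.
  - exact: closed_closure.
  - by exists x; apply: subset_closure; exact: subset_reach.
  - exact: closure_invariant (reach_invariant _ _).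
  have CV : C `<=` V.
    apply: subset_trans Cx _; apply: subset_trans WV; apply: closureS.
    by apply: reach_least => // _ ->.
  have AC : A `&` C !=set0.
    apply: contrapT => AC; apply: nC; exists C; split=> // y Cy.
    by split; [exact: CV|move=> Ay; apply: AC; exists y].
  by rewrite /basin/= (minimal_set_eq mA mC AC).
have basinT : basin A = setT.
  apply: conX.
  - by case: A0 => a /AW/Wbasin; exists a.
  - by exists (basin A); rewrite ?setTI//; exact: open_basin Wbasin _.
  - by exists (basin A); rewrite ?setTI//; exact: closed_basin.
have [_ [b Bb] _ _] := mB.
have : basin A b by rewrite basinT.
rewrite /basin/= (minimal_set_reach lscF mB Bb) => sAB.
apply: AB; apply: minimal_set_eq mA mB _.
by case: A0 => a Aa; exists a; split=> //; exact: sAB.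
Qed.

(** * Consequences *)

Lemma minimal_set_stable {A : set X} : compact [set: X] ->
    multifunction F -> lsc F -> robust F ->
  minimal_set F A -> lyapunov_stable F A.
Proof.
move=> cptX F0 lscF robF mA V oV AV.
have [W [oW AW iW WV]] := minimal_set_nbhs cptX F0 lscF robF mA oV AV.
exists W; split=> //; apply: subset_trans (reach_least _ iW) _ => // x Wx.
by apply: WV; exact: subset_closure.
Qed.

Lemma omega_limit_minimal {A : set X} {f : X -> X} (x : X) :
    compact [set: X] -> lsc F -> robust F ->
    (forall x, F x = [set f x]) -> unique (minimal_set F) A ->
  \bigcap_(N : nat) closure [set iter n f x | n in [set n | (N <= n)%N]] = A.
Proof.
move=> cptX lscF robF Ff [mA uA]; have [cA [a Aa] _ _] := mA.
pose tail N := [set iter n f x | n in [set n | (N <= n)%N]].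
have invP S : minvariant F S <-> forall y, S y -> S (f y).
  split=> [iS y Sy|iS z [y Sy]]; first by apply: iS; exists y; rewrite ?Ff.
  by rewrite Ff => ->; exact: iS.
have Atail N : A `<=` closure (tail N).
  have [|||B mB BN] := @exists_minimal_set X F (closure (tail N)) cptX.
  - exact: closed_closure.
  - by exists (iter N f x); apply: subset_closure; exists N => /=.
  - apply: closure_invariant => //; apply/invP => _ [n /= Nn <-].
    by exists n.+1 => //=; exact: leqW.
  by rewrite (uA B mB).
apply/seteqP; split; last by move=> y Ay N _; exact: Atail.
move=> y xy; apply: contrapT => Ay.
have F0 : multifunction F by move=> z; rewrite Ff; exists (f z).
have [||W [oW AW /invP iW WV]] :=
    @minimal_set_nbhs A (~` [set y]) cptX F0 lscF robF mA.
- apply: closed_openC.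
  exact/accessible_closed_set1/hausdorff_accessible/metric_hausdorff.
- by move=> z Az /= zy; rewrite zy in Az.
(* The orbit enters [W], which is invariant and stays away from [y]. *)
have [_ [[N _ <-] WN]] : tail 0%N `&` W !=set0.
  by apply: (Atail 0%N a Aa); apply: open_nbhs_nbhs; split=> //; exact: AW.
apply: (WV y) => //; apply: closureS (xy N I) => _ [n /= Nn <-].
rewrite -(subnK Nn) iterD; elim: (n - N)%N => //= k; exact: iW.
Qed.

End Metric.

(** Among finitely many minimal sets each one is isolated from the union of the
    others, which is closed and disjoint from it. *)
Lemma infinite_of_not_isolated {X : topologicalType} (F : X -> set X) :
  (exists A, minimal_set F A) ->
  (forall A V, minimal_set F A -> open V -> A `<=` V ->
    exists B, minimal_set F B /\ B `<=` V `\` A) ->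
  infinite_set [set A | minimal_set F A].
Proof.
move=> [A mA] acc finM.
pose V := ~` \bigcup_(B in [set A | minimal_set F A] `\` [set A]) B.
have oV : open V.
  apply: closed_openC; apply: closed_bigcup => [|B [[cB]]//].
  exact: finite_setD.
have AV : A `<=` V.
  move=> x Ax [B [/= mB BA] Bx]; apply: BA.
  by apply: minimal_set_eq mB mA _; exists x.
have [B [mB BVA]] := acc A V mA oV AV.
have [_ [x Bx] _ _] := mB; have [Vx Ax] := BVA x Bx.
apply: Vx; exists B => //; split=> //= BA.
by apply: Ax; rewrite -BA.
Qed.

Theorem theorem3 (R : realType) (X : metricType R) (F : X -> set X)
    (X_nonempty : [set: X] !=set0)
    (X_compact : compact [set: X])
    (X_connected : connected [set: X])
    (F_multifunction : multifunction F)
    (F_continuous : mcontinuous F)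
    (F_robust : robust F) :
  ((exists A : set X, unique (minimal_set F) A /\ lyapunov_stable F A)
   \/
   [/\ infinite_set [set A : set X | minimal_set F A],
       forall A : set X, minimal_set F A -> lyapunov_stable F A &
       forall A V : set X, minimal_set F A -> open V -> A `<=` V ->
         exists B : set X, minimal_set F B /\ B `<=` V `\` A])
  /\
  (forall A : set X, unique (minimal_set F) A -> lyapunov_stable F A ->
     forall f : X -> X, (forall x, F x = [set f x]) ->
     forall x : X,
       \bigcap_(N : nat) closure [set iter n f x | n in [set n | (N <= n)%N]]
       = A).
Proof.
have [lscF _] := F_continuous.
have stable A : minimal_set F A -> lyapunov_stable F A.
  exact: minimal_set_stable.
split; last first.
  move=> A uA _ f Ff x.
  exact: omega_limit_minimal X_compact lscF F_robust Ff uA.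
have [A mA _] := exists_minimal_set X_compact closedT X_nonempty
  (fun y (_ : mimage F setT y) => I).
have [uA|nuA] := pselect (unique (minimal_set F) A).
  by left; exists A; split=> //; exact: stable.
right.
have acc (B V : set X) : minimal_set F B -> open V -> B `<=` V ->
    exists C : set X, minimal_set F C /\ C `<=` V `\` B.
  move=> mB.
  have [C [mC BC]] : exists C, minimal_set F C /\ B <> C.
    apply: contrapT => nC; apply: nuA; split=> // C mC.
    have eqB D : minimal_set F D -> B = D.
      by move=> mD; apply: contrapT => BD; apply: nC; exists D.
    by rewrite -(eqB A mA) -(eqB C mC).
  exact: minimal_set_not_isolated mB mC BC.
by split=> //; apply: infinite_of_not_isolated => //; exists A.
Qed.
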